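(* Let $Q$ be a medial quandle and $e\in Q$. Then the orbit $Qe$, as a subquandle of $Q$, is equal to the affine quandle $\mathrm{Aff}(\mathrm{Orb}_Q(e),L_e)$, where $L_e$ denotes here the restriction of the left translation by $e$ to $Qe$, which is an automorphism of the group $\mathrm{Orb}_Q(e)$.
   Context: A quandle is a non-empty set $Q$ with a binary operation such that for all $x,y,z$: $xx=x$; $x(yz)=(xy)(xz)$; and $xu=y$ has a unique solution $u\in Q$. It is medial if $(xy)(uv)=(xu)(yv)$ for all $x,y,u,v\in Q$. The left translation by $a$ is the permutation $L_a:Q\to Q$, $x\mapsto ax$. $\mathrm{LMlt}(Q)$ is the permutation group generated by all $L_a$ ($a\in Q$) and $\mathrm{Dis}(Q)$ is its subgroup generated by all $L_aL_b^{-1}$ ($a,b\in Q$). Both groups have the same orbits on $Q$, called the orbits of $Q$; the orbit containing $e$ is $Qe=\{\alpha(e):\alpha\in\mathrm{Dis}(Q)\}$, and it is a subquandle. For $Q$ medial, $\mathrm{Dis}(Q)$ is abelian, and the orbit group $\mathrm{Orb}_Q(e)=(Qe,+,-,e)$ is the abelian group on $Qe$ with zero element $e$ and operations $\alpha(e)+\beta(e)=\alpha\beta(e)$, $-\alpha(e)=\alpha^{-1}(e)$ for $\alpha,\beta\in\mathrm{Dis}(Q)$. For an abelian group $A$ and an automorphism $f$ of $A$, the affine quandle $\mathrm{Aff}(A,f)$ is the set $A$ with the operation $a*b=(1-f)(a)+f(b)$. *)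

(* Defs.v *)
From HB Require Import structures.
From mathcomp Require Import all_boot all_algebra.
From mathcomp Require Import boolp classical_sets.

Set Implicit Arguments.
Unset Strict Implicit.
Unset Printing Implicit Defensive.

Import GRing.Theory.
Local Open Scope classical_set_scope.
Local Open Scope ring_scope.

Reserved Notation "x ▷ y" (at level 40, left associativity).

(* The field [qinh] is the non-emptiness requirement. *)
Record quandle := Quandle {
  qcar :> Type;
  qop : qcar -> qcar -> qcar;
  qinh : inhabited qcar;
  qidem : forall x, qop x x = x;
  qdist : forall x y z, qop x (qop y z) = qop (qop x y) (qop x z);
  qdiv : forall x y, exists! u, qop x u = y }.

Notation "x ▷ y" := (qop x y).

Definition medial (Q : quandle) : Prop :=
  forall x y u v : Q, (x ▷ y) ▷ (u ▷ v) = (x ▷ u) ▷ (y ▷ v).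

Section SubQuandle.
Variables (Q : quandle) (S : set Q) (x0 : Q).
Hypothesis S0 : S x0.
Hypothesis S_op : forall x y, S x -> S y -> S (x ▷ y).
Hypothesis S_div : forall x y, S x -> S (x ▷ y) -> S y.

Definition sub_op (x y : {x | S x}) : {x | S x} :=
  exist _ (sval x ▷ sval y) (S_op (svalP x) (svalP y)).

Lemma sub_val_inj (x y : {x | S x}) : sval x = sval y -> x = y.
Proof.
by case: x y => [x Sx] [y Sy] /= h; subst y; congr exist; exact: Prop_irrelevance.
Qed.

Lemma sub_inh : inhabited {x | S x}.
Proof. exact: (inhabits (exist _ x0 S0)). Qed.

Lemma sub_idem x : sub_op x x = x.
Proof. by apply: sub_val_inj; exact: qidem. Qed.

Lemma sub_dist x y z : sub_op x (sub_op y z) = sub_op (sub_op x y) (sub_op x z).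
Proof. by apply: sub_val_inj; exact: qdist. Qed.

Lemma sub_div x y : exists! u, sub_op x u = y.
Proof.
have [u [xu u_uniq]] := qdiv (sval x) (sval y).
have Su : S u by apply: (S_div (svalP x)); rewrite xu; exact: svalP.
exists (exist _ u Su); split=> [|v xv]; first exact: sub_val_inj.
by apply: sub_val_inj; apply: u_uniq; rewrite -xv.
Qed.

Definition subquandle : quandle := Quandle sub_inh sub_idem sub_dist sub_div.

End SubQuandle.

(* The group of all permutations of an arbitrary type. *)
Record sym (T : Type) := Sym {
  sym_fun :> T -> T;
  sym_inv : T -> T;
  sym_funK : cancel sym_fun sym_inv;
  sym_invK : cancel sym_inv sym_fun }.

Section SymGroup.
Variable T : Type.
Implicit Types f g h : sym T.

HB.instance Definition _ := gen_eqMixin (sym T).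
HB.instance Definition _ := gen_choiceMixin (sym T).

Lemma symP f g : f =1 g -> f = g.
Proof.
case: f g => [f f' fK f'K] [g g' gK g'K] /= /funext fg; subst g.
have fg' : f' = g' by apply: funext => x; rewrite -[in LHS](g'K x) fK.
by subst g'; congr Sym; exact: Prop_irrelevance.
Qed.

Definition sym1 : sym T := @Sym T id id (fun _ => erefl) (fun _ => erefl).
Definition symV f : sym T := Sym (@sym_invK T f) (@sym_funK T f).
Definition symM f g : sym T :=
  Sym (can_comp (@sym_funK T f) (@sym_funK T g))
      (can_comp (@sym_invK T g) (@sym_invK T f)).

Lemma symMA : associative symM. Proof. by move=> f g h; exact: symP. Qed.
Lemma sym1M : left_id sym1 symM. Proof. by move=> f; exact: symP. Qed.
Lemma symM1 : right_id sym1 symM. Proof. by move=> f; exact: symP. Qed.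
Lemma symVM : left_inverse sym1 symV symM.
Proof. by move=> f; apply: symP; exact: sym_funK. Qed.
Lemma symMV : right_inverse sym1 symV symM.
Proof. by move=> f; apply: symP; exact: sym_invK. Qed.

HB.instance Definition _ :=
  isGroup.Build (sym T) symMA sym1M symM1 symVM symMV.

Lemma sym1E x : (1%g : sym T) x = x. Proof. by []. Qed.
Lemma symME f g x : (f * g)%g x = f (g x). Proof. by []. Qed.

End SymGroup.

Section Translations.
Variable Q : quandle.
Implicit Types a b x y : Q.

Definition ldiv a y : Q := sval (cid (qdiv a y)).

Lemma ldivK a : cancel (ldiv a) (qop a).
Proof. by move=> y; rewrite /ldiv; case: cid => u []. Qed.

Lemma qopK a : cancel (qop a) (ldiv a).
Proof. by move=> x; rewrite /ldiv; case: cid => u [_ u_uniq] /=; exact: u_uniq. Qed.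

Definition Lt a : sym Q := Sym (@qopK a) (@ldivK a).

Definition Dis : set (sym Q) :=
  smallest (fun G : set (sym Q) => group_closed [in G])
    [set alpha | exists a b, alpha = (Lt a / Lt b)%g].

Definition orbit (e : Q) : set Q := [set alpha e | alpha in Dis].

Lemma Dis1 : Dis 1%g.
Proof. by move=> G [[G1 _] _]; exact: set_mem. Qed.

Lemma DisF f g : Dis f -> Dis g -> Dis (f / g)%g.
Proof.
move=> Df Dg G HG; apply: set_mem.
by apply: HG.1.2; apply: mem_set; [exact: Df|exact: Dg].
Qed.

Lemma DisV f : Dis f -> Dis (f^-1)%g.
Proof. by move=> Df; rewrite -[(f^-1)%g]mul1g; exact: DisF Dis1 Df. Qed.

Lemma DisM f g : Dis f -> Dis g -> Dis (f * g)%g.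
Proof. by move=> Df Dg; rewrite -[g]invgK; exact: DisF Df (DisV Dg). Qed.

Lemma Dis_gen a b : Dis (Lt a / Lt b)%g.
Proof. by move=> G [_]; apply; exists a, b. Qed.

Lemma Dis_ind (P : sym Q -> Prop) :
  (forall a b, P (Lt a / Lt b)%g) -> P 1%g ->
  (forall f g, P f -> P g -> P (f / g)%g) -> forall f, Dis f -> P f.
Proof.
move=> Pgen P1 PF f; apply; split; last by move=> _ [a [b ->]].
split=> [|g h /set_mem Pg /set_mem Ph]; apply: mem_set => //.
exact: PF.
Qed.

Lemma orbit_refl e : orbit e e.
Proof. by exists 1%g; [exact: Dis1|exact: sym1E]. Qed.

Lemma orbit_Dis e f x : Dis f -> orbit e x -> orbit e (f x).
Proof. by move=> Df [g Dg <-]; exists (f * g)%g => //; exact: DisM. Qed.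

Lemma orbit_op_r e x y : orbit e y -> orbit e (x ▷ y).
Proof.
move=> ey; suff -> : x ▷ y = (Lt x / Lt y)%g y.
  by apply: orbit_Dis => //; exact: Dis_gen.
by rewrite symME /= -{3}(qidem y) qopK.
Qed.

Lemma Lt_op x y : Lt (x ▷ y) = (Lt x * Lt y / Lt x)%g.
Proof.
by apply: symP => z; rewrite !symME /= qdist ldivK.
Qed.

Lemma orbit_op_inv e x y : orbit e (x ▷ y) -> orbit e y.
Proof.
move=> exy.
suff -> : y = (Lt y / Lt x)%g (x ▷ y).
  by apply: orbit_Dis => //; exact: Dis_gen.
by rewrite symME /= qopK qidem.
Qed.

Lemma orbit_op e x y : orbit e x -> orbit e y -> orbit e (x ▷ y).
Proof. by move=> _; exact: orbit_op_r. Qed.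

Lemma orbit_div e x y : orbit e x -> orbit e (x ▷ y) -> orbit e y.
Proof. by move=> _; exact: orbit_op_inv. Qed.

Definition orbit_quandle (e : Q) : quandle :=
  subquandle (orbit_refl e) (@orbit_op e) (@orbit_div e).

Definition orbit_L (e : Q) (x : {x | orbit e x}) : {x | orbit e x} :=
  exist _ (e ▷ sval x) (orbit_op (orbit_refl e) (svalP x)).

Hypothesis Qm : medial Q.

Lemma Lt_medial x y u : (Lt y / Lt x * Lt u = Lt u / Lt x * Lt y)%g.
Proof.
apply: (@mulgI _ (Lt x)); rewrite !mulgA -!Lt_op.
by apply: symP => v; exact: Qm.
Qed.

Lemma Dis_genC a b c d : commute (Lt a / Lt b)%g (Lt c / Lt d)%g.
Proof.
have C x y u : commute (Lt y / Lt x)%g (Lt u / Lt x)%g.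
  by rewrite /commute !mulgA Lt_medial.
have -> : (Lt c / Lt d = (Lt c / Lt b) * (Lt d / Lt b)^-1)%g.
  by rewrite invgF mulgA mulgVK.
by apply: commuteM => //; apply: commuteV.
Qed.

Lemma Dis_comm f g : Dis f -> Dis g -> commute f g.
Proof.
move=> Df Dg; move: f Df; apply: Dis_ind.
- move=> a b; move: g Dg; apply: Dis_ind.
  + by move=> c d; exact: Dis_genC.
  + exact: commute1.
  + by move=> h k ch ck; apply: commuteM => //; exact: commuteV.
- exact/commute_sym/commute1.
- move=> h k ch ck; apply: commute_sym; apply: commuteM; first exact: commute_sym.
  by apply: commuteV; exact: commute_sym.
Qed.

End Translations.

(* The carrier of the orbit group; its group structure needs mediality. *)
Definition Orb (Q : quandle) (Qm : medial Q) (e : Q) : Type := {x | orbit e x}.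

Section OrbitGroup.
Variables (Q : quandle) (Qm : medial Q) (e : Q).
Local Notation Qe := (Orb Qm e).
Implicit Types x y z : Qe.

HB.instance Definition _ := gen_eqMixin Qe.
HB.instance Definition _ := gen_choiceMixin Qe.

Definition Orb_of (alpha : sym Q) (Da : Dis alpha) : Qe :=
  exist _ (alpha e) (ex_intro2 _ _ alpha Da erefl).

(* A chosen displacement carrying [e] to [x]; by [Orb_addE] and [Orb_oppE] below
   the group operations do not depend on this choice. *)
Definition rep x : sym Q := s2val (cid2 (svalP x)).

Lemma rep_Dis x : Dis (rep x).
Proof. by rewrite /rep; case: cid2. Qed.

Lemma rep_e x : rep x e = sval x.
Proof. by rewrite /rep; case: cid2. Qed.

Definition Orb_zero : Qe := exist _ e (orbit_refl e).
Definition Orb_add x y : Qe := Orb_of (DisM (rep_Dis x) (rep_Dis y)).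
Definition Orb_opp x : Qe := Orb_of (DisV (rep_Dis x)).

Lemma Dis_eq f g h : Dis f -> Dis g -> Dis h -> f e = g e -> f (h e) = g (h e).
Proof.
move=> Df Dg Dh fg; rewrite -!symME (Dis_comm Qm Df Dh) (Dis_comm Qm Dg Dh).
by rewrite !symME fg.
Qed.

Lemma Orb_addE alpha beta (Da : Dis alpha) (Db : Dis beta) :
  Orb_add (Orb_of Da) (Orb_of Db) = Orb_of (DisM Da Db).
Proof.
apply: sub_val_inj; rewrite /= !rep_e /=.
by apply: Dis_eq => //; rewrite ?rep_e //; exact: rep_Dis.
Qed.

Lemma Orb_oppE alpha (Da : Dis alpha) : Orb_opp (Orb_of Da) = Orb_of (DisV Da).
Proof.
apply: sub_val_inj => /=; set r := rep _.
have Dr : Dis r by exact: rep_Dis.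
have re : r e = alpha e by rewrite rep_e.
have -> : sym_inv r e = (r^-1 * alpha^-1)%g (alpha e).
  by rewrite symME /= sym_funK.
rewrite (Dis_comm Qm (DisV Dr) (DisV Da)) symME /= -re.
by rewrite sym_funK.
Qed.

Lemma Orb_ofP x : exists2 alpha, Dis alpha & forall Da : Dis alpha, x = Orb_of Da.
Proof.
exists (rep x) => [|Da]; first exact: rep_Dis.
by apply: sub_val_inj; rewrite /= rep_e.
Qed.

Lemma Orb_addA : associative Orb_add.
Proof.
move=> x y z; have [f Df ->] := Orb_ofP x; have [g Dg ->] := Orb_ofP y.
have [h Dh ->] := Orb_ofP z.
by rewrite !Orb_addE; exact: sub_val_inj.
Qed.

Lemma Orb_addC : commutative Orb_add.
Proof.
move=> x y; have [f Df ->] := Orb_ofP x; have [g Dg ->] := Orb_ofP y.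
rewrite !Orb_addE; apply: sub_val_inj => /=.
by rewrite -!symME (Dis_comm Qm Df Dg).
Qed.

Lemma Orb_zeroE : Orb_zero = Orb_of (@Dis1 Q).
Proof. exact: sub_val_inj. Qed.

Lemma Orb_add0 : left_id Orb_zero Orb_add.
Proof.
move=> x; have [f Df ->] := Orb_ofP x.
by rewrite Orb_zeroE !Orb_addE; exact: sub_val_inj.
Qed.

Lemma Orb_addN : left_inverse Orb_zero Orb_opp Orb_add.
Proof.
move=> x; have [f Df ->] := Orb_ofP x.
rewrite Orb_oppE Orb_addE; apply: sub_val_inj => /=.
exact: sym_funK.
Qed.

HB.instance Definition _ :=
  GRing.isZmodule.Build Qe Orb_addA Orb_addC Orb_add0 Orb_addN.

End OrbitGroup.

Definition is_automorphism (A : zmodType) (f : A -> A) : Prop :=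
  zmod_morphism f /\ bijective f.

Section Affine.
Variables (A : zmodType) (f : A -> A) (fA : is_automorphism f).
Implicit Types a b c : A.

Definition aff_op a b : A := (idfun \- f) a + f b.

Lemma aff_opp : {morph f : a / - a}.
Proof.
have [fB _] := fA; have f0 : f 0 = 0 by rewrite -{1}(subrr 0) fB subrr.
by move=> a; rewrite -sub0r fB f0 sub0r.
Qed.

Lemma aff_add : {morph f : a b / a + b}.
Proof. by move=> a b; rewrite -{1}[b]opprK fA.1 aff_opp opprK. Qed.

Lemma aff_inh : inhabited A. Proof. exact: (inhabits 0). Qed.

Lemma aff_idem a : aff_op a a = a. Proof. by rewrite /aff_op /= subrK. Qed.

Lemma aff_dist a b c :
  aff_op a (aff_op b c) = aff_op (aff_op a b) (aff_op a c).
Proof.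
have cancelP (x p q r : A) : x - (p + q) + (p + r) = x + (- q + r).
  by rewrite opprD -!addrA (addrCA (- q)) addKr.
rewrite /aff_op /= !(aff_add, aff_opp) cancelP.
by rewrite !addrA.
Qed.

Lemma aff_div a c : exists! b, aff_op a b = c.
Proof.
have [g fK gK] := fA.2.
exists (g (c - (a - f a))); split=> [|b <-].
  by rewrite /aff_op gK addrC subrK.
by rewrite /aff_op addrC addKr fK.
Qed.

Definition Aff : quandle := Quandle aff_inh aff_idem aff_dist aff_div.

End Affine.

(* Main.v *)
Require Import Defs.
From mathcomp Require Import all_boot all_algebra.
From mathcomp Require Import boolp classical_sets.

(** Every displacement [f] is an automorphism of [Q], so that
    [Lt (f e) = f * Lt e / f] ([Lt_morph]), and conjugation by [Lt e] maps
    displacements to displacements ([Dis_conj]).  Write [f^c] for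
    [Lt e * f / Lt e].  Since [Lt e] fixes [e], it sends [f e] to [f^c e]: on
    the orbit, the translation by [e] is the group automorphism induced by the
    conjugation [f |-> f^c] ([orbit_LE], [orbit_L_automorphism]).

    For displacements [f] and [g],
      [f e ▷ g e = (f * Lt e / f * g) e = (f * (f^c)^-1 * g^c) e],
    and the right-hand side is by definition [f e - Lt e (f e) + Lt e (g e)] in
    the orbit group, which is the affine operation ([orbit_op_affine]). *)

Set Implicit Arguments.
Unset Strict Implicit.
Unset Printing Implicit Defensive.

Import GRing.Theory.
Local Open Scope ring_scope.

Section Displacements.
Variable Q : quandle.
Implicit Types (a e x : Q) (f g : sym Q).

Lemma sym_inv_morph f : {morph f : x y / x ▷ y} -> {morph sym_inv f : x y / x ▷ y}.
Proof.
by move=> fM x y; apply: (can_inj (sym_funK f)); rewrite fM !sym_invK.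
Qed.

Lemma Dis_morph f : Dis f -> {morph f : x y / x ▷ y}.
Proof.
have LtM a : {morph Lt a : x y / x ▷ y} by move=> x y; exact: qdist.
have divM (g h : sym Q) : {morph g : x y / x ▷ y} -> {morph h : x y / x ▷ y} ->
    {morph (g / h)%g : x y / x ▷ y}.
  by move=> gM hM x y; rewrite !symME /= (sym_inv_morph hM) gM.
move: f; apply: Dis_ind => // a b; exact: divM.
Qed.

Lemma Lt_morph f x : {morph f : x y / x ▷ y} -> Lt (f x) = (f * Lt x / f)%g.
Proof. by move=> fM; apply: symP => y; rewrite !symME /= fM sym_invK. Qed.

(** Conjugation by [Lt a] sends the generator [Lt b / Lt c] to the generator
    [Lt (a ▷ b) / Lt (a ▷ c)]. *)
Lemma Dis_conj a f : Dis f -> Dis (Lt a * f / Lt a)%g.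
Proof.
move: f; apply: Dis_ind.
- move=> b c.
  suff -> : (Lt a * (Lt b / Lt c) / Lt a = Lt (a ▷ b) / Lt (a ▷ c))%g.
    exact: Dis_gen.
  by rewrite !Lt_op !invgF !invgM !mulgA !mulgVK.
- by rewrite mulg1 mulgV; exact: Dis1.
- move=> f g Df Dg.
  suff -> : (Lt a * (f / g) / Lt a
             = (Lt a * f / Lt a) / (Lt a * g / Lt a))%g by exact: DisF.
  by rewrite !invgF !invgM !mulgA !mulgVK.
Qed.

Lemma ldiv_idem e : ldiv e e = e.
Proof. by rewrite -{2}(qidem e) qopK. Qed.

End Displacements.

Section Orbit.
Variables (Q : quandle) (Qm : medial Q) (e : Q).
Local Notation Qe := (Orb Qm e).
Implicit Types (x y : Qe) (f g : sym Q).

Lemma Orb_addrE f g (Df : Dis f) (Dg : Dis g) :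
  Orb_of Qm e Df + Orb_of Qm e Dg = Orb_of Qm e (DisM Df Dg).
Proof. exact: Orb_addE. Qed.

Lemma Orb_subrE f g (Df : Dis f) (Dg : Dis g) :
  Orb_of Qm e Df - Orb_of Qm e Dg = Orb_of Qm e (DisF Df Dg).
Proof.
have -> : - Orb_of Qm e Dg = Orb_of Qm e (DisV Dg) by exact: Orb_oppE.
by rewrite Orb_addrE; exact: sub_val_inj.
Qed.

(** As [Lt e] fixes [e], it carries [f e] to the value at [e] of the conjugate
    of [f] by [Lt e]. *)
Lemma orbit_LE f (Df : Dis f) :
  orbit_L (Orb_of Qm e Df) = Orb_of Qm e (Dis_conj e Df).
Proof. by apply: sub_val_inj; rewrite /= ldiv_idem. Qed.

Lemma orbit_L_automorphism : is_automorphism (A := Qe) (@orbit_L Q e).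
Proof.
split=> [x y|].
  have [f Df ->] := Orb_ofP x; have [g Dg ->] := Orb_ofP y.
  rewrite Orb_subrE !orbit_LE Orb_subrE; apply: sub_val_inj => /=.
  by rewrite qopK.
have invP x : Defs.orbit e (ldiv e (sval x)).
  by apply: (@orbit_op_inv Q e e); rewrite ldivK; exact: svalP.
exists (fun x => exist _ (ldiv e (sval x)) (invP x)) => x; apply: sub_val_inj.
- exact: qopK.
- exact: ldivK.
Qed.

Lemma orbit_op_affine x y :
  sub_op (@orbit_op Q e) x y = aff_op (A := Qe) (@orbit_L Q e) x y.
Proof.
have [f Df ->] := Orb_ofP x; have [g Dg ->] := Orb_ofP y.
rewrite /aff_op /= !orbit_LE Orb_subrE Orb_addrE; apply: sub_val_inj.
rewrite -[LHS]/(Lt (f e) (g e)) (Lt_morph _ (Dis_morph Df)).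
by rewrite /= ldiv_idem qopK.
Qed.

End Orbit.

Lemma Quandle_ext (T : Type) (op op' : T -> T -> T) inh inh' idem idem'
    dist dist' div div' :
  op =2 op' ->
  @Quandle T op inh idem dist div = @Quandle T op' inh' idem' dist' div'.
Proof.
move=> eq_op; have {eq_op} eq_op : op = op'.
  by apply: funext => x; apply: funext.
by subst op'; congr Quandle; exact: Prop_irrelevance.
Qed.

Theorem proposition3p3 (Q : quandle) (Qm : medial Q) (e : Q) :
  exists Le_aut : is_automorphism (A := Orb Qm e) (@orbit_L Q e),
    orbit_quandle e = Aff Le_aut.
Proof.
exists (orbit_L_automorphism Qm e).
(* [Orb Qm e] unfolds to the carrier of [orbit_quandle e], so the equality of
   the two quandles reduces to that of their operations. *)
by apply: Quandle_ext => x y; exact: orbit_op_affine.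
Qed.
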